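(* Let $(X,S)$ be an equicontinuous semiflow, where $S$ is a monoid and $X$ is a compact metric space, and let $(2^X,S)$ be the induced semiflow. Then $E(X,S)$ is conjugate to $E(2^X,S)$; that is, there is a homeomorphism $h:E(2^X,S)\to E(X,S)$ with $h(sp)=s\,h(p)$ for all $s\in S$ and $p\in E(2^X,S)$.
   Context: A semiflow $(X,S)$ is an action of a (discrete) monoid $S$ on a compact metric space $(X,d)$ by continuous (not necessarily injective or surjective) maps, the identity of $S$ acting as the identity map. It is equicontinuous if for every $y\in X$ and $\epsilon>0$ there is a neighbourhood $U$ of $y$ with $d(sx,sy)<\epsilon$ for all $x\in U$, $s\in S$. $2^X$ is the space of all nonempty closed subsets of $X$ with the Vietoris (equivalently Hausdorff metric) topology; $S$ acts on $2^X$ by $sA=\{sa:a\in A\}$. For a semiflow $(Y,S)$, the enveloping semigroup $E(Y,S)$ is the closure in $Y^Y$ (product topology) of the set of maps $y\mapsto sy$, $s\in S$; $S$ acts on $E(Y,S)$ by $sp=s\circ p$. Conjugate means there is an $S$-equivariant homeomorphism. *)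

(* Defs.v *)
From HB Require Import structures.
From mathcomp Require Import all_boot all_order all_algebra finmap.
From mathcomp Require Import all_classical all_reals all_analysis.

Set Implicit Arguments.
Unset Strict Implicit.
Unset Printing Implicit Defensive.

Local Open Scope classical_set_scope.
Local Open Scope ring_scope.

(* Compactness and metrizability of the phase space are not part of this
   record: they are assumed of the space itself, and phase spaces such as
   enveloping semigroups need not be metrizable. *)
Record semiflow (S : monoidType) (X : topologicalType) := Semiflow {
  flow :> S -> X -> X ;
  flow1 : forall x, flow 1%g x = x ;
  flowM : forall s t x, flow (s * t)%g x = flow s (flow t x) ;
  flow_continuous : forall s, continuous (flow s) }.

(* The library's [equicontinuous] requires a pointed codomain, and so would
   exclude the empty space. *)
Definition equicontinuous_semiflow (R : realType) (S : monoidType)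
    (X : metricType R) (phi : semiflow S X) : Prop :=
  forall (y : X) (e : R), 0 < e ->
    exists2 U : set X, nbhs y U &
      forall x s, U x -> mdist (phi s x) (phi s y) < e.

Definition homeomorphism (X Y : topologicalType) (h : X -> Y) : Prop :=
  continuous h /\ exists g : Y -> X, [/\ continuous g, cancel h g & cancel g h].

Definition conjugate (S : monoidType) (X Y : topologicalType)
    (phi : semiflow S X) (psi : semiflow S Y) : Prop :=
  exists h : X -> Y,
    homeomorphism h /\ forall s x, h (phi s x) = psi s (h x).

Record hyperspace (X : topologicalType) := Hyperspace {
  hyper_set :> set X ;
  hyper_closed : closed hyper_set ;
  hyper_neq0 : hyper_set !=set0 }.

Lemma hyperspace_inj (X : topologicalType) : injective (@hyper_set X).
Proof.
move=> [A cA A0] [B cB B0] /= AB; move: cA A0 cB B0; rewrite AB => *.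
congr Hyperspace; exact: Prop_irrelevance.
Qed.

HB.instance Definition _ (X : topologicalType) := gen_eqMixin (hyperspace X).
HB.instance Definition _ (X : topologicalType) :=
  gen_choiceMixin (hyperspace X).

Definition vietoris_subbase (X : topologicalType) (i : bool * set X) :
    set (hyperspace X) :=
  if i.1 then [set A | A `<=` i.2] else [set A | A `&` i.2 !=set0].

(* The Vietoris topology: the subbase is indexed by the pairs (b, U) with U
   open, b selecting between the "contained in U" and the "meets U" sets. *)
HB.instance Definition _ (X : topologicalType) :=
  isSubBaseTopological.Build (hyperspace X)
    [set i : bool * set X | open i.2] (@vietoris_subbase X).

Lemma hyperspace_cvg (T X : topologicalType) (f : T -> hyperspace X) (x : T) :
  (forall i : bool * set X, open i.2 -> vietoris_subbase i (f x) ->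
     nbhs x (f @^-1` vietoris_subbase i)) ->
  {for x, continuous f}.
Proof.
move=> fi U [_ [[D' sD' <-] [W D'W Wfx] sU]].
apply: (@filterS _ (nbhs x) _ (f @^-1` W)).
  by move=> t Wt; apply: sU; exists W.
have [L sL WE] := sD' _ D'W; rewrite -WE preimage_bigcap.
apply: filter_bigI => i iL; apply: fi.
  by have := sL _ iL; rewrite inE.
by move: Wfx; rewrite -WE; exact.
Qed.

Section hyperspace_semiflow.
Context (R : realType) (S : monoidType) (X : metricType R).
Hypothesis cX : compact [set: X].
Variable phi : semiflow S X.

Lemma closed_image_flow (s : S) (A : hyperspace X) : closed (phi s @` A).
Proof.
apply: compact_closed; first exact: metric_hausdorff.
apply: continuous_compact.
  by apply: continuous_subspaceT; exact: flow_continuous.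
by apply: (subclosed_compact _ cX) => //; exact: hyper_closed.
Qed.

Lemma image_flow_neq0 (s : S) (A : hyperspace X) : phi s @` A !=set0.
Proof. by have [x Ax] := hyper_neq0 A; exists (phi s x), x. Qed.

Definition hyper_flow (s : S) (A : hyperspace X) : hyperspace X :=
  Hyperspace (@closed_image_flow s A) (image_flow_neq0 s A).

Lemma hyper_flow1 A : hyper_flow 1%g A = A.
Proof.
apply: hyperspace_inj => /=; apply/seteqP; split=> [_ [x Ax <-]|x Ax].
  by rewrite flow1.
by exists x => //; rewrite flow1.
Qed.

Lemma hyper_flowM s t A :
  hyper_flow (s * t)%g A = hyper_flow s (hyper_flow t A).
Proof.
apply: hyperspace_inj => /=; rewrite image_comp.
by apply: eq_imagel => x _ /=; rewrite flowM.
Qed.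

Lemma vietoris_subbase_flow s (b : bool) (U : set X) (A : hyperspace X) :
  vietoris_subbase (b, U) (hyper_flow s A) =
  vietoris_subbase (b, phi s @^-1` U) A.
Proof.
rewrite /vietoris_subbase; case: b => /=; apply/propext; split.
- by move=> sU x Ax; apply: sU; exists x.
- by move=> sU _ [x Ax <-]; exact: sU.
- by move=> [_ [[x Ax <-] Ux]]; exists x.
- by move=> [x [Ax Ux]]; exists (phi s x); split=> //; exists x.
Qed.

Lemma hyper_flow_continuous s : continuous (hyper_flow s).
Proof.
move=> A; apply: hyperspace_cvg => -[b U] /= oU.
have -> : hyper_flow s @^-1` vietoris_subbase (b, U) =
    vietoris_subbase (b, phi s @^-1` U).
  by apply/funext => B /=; rewrite vietoris_subbase_flow.
rewrite vietoris_subbase_flow => fA.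
have oV : open (phi s @^-1` U).
  by apply: open_comp oU => x _; exact: flow_continuous.
exists (vietoris_subbase (b, phi s @^-1` U)); split=> //.
exists [set vietoris_subbase (b, phi s @^-1` U)]; last by rewrite bigcup_set1.
move=> _ ->; exists [fset (b, phi s @^-1` U)]%fset.
  by move=> i; rewrite !inE => /eqP ->.
by rewrite set_fset1 bigcap_set1.
Qed.

Definition hyperspace_semiflow : semiflow S (hyperspace X) :=
  Semiflow hyper_flow1 hyper_flowM hyper_flow_continuous.

End hyperspace_semiflow.

Section enveloping_semigroup.
Context (S : monoidType) (Y : topologicalType) (phi : semiflow S Y).

Definition enveloping : set {ptws Y -> Y} :=
  closure (range (flow phi : S -> {ptws Y -> Y})).

Lemma ptws_comp_continuous (f : Y -> Y) : continuous f ->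
  continuous (fun p : {ptws Y -> Y} => f \o p : {ptws Y -> Y}).
Proof.
move=> cf p.
have Fp : Filter ((fun q : {ptws Y -> Y} => f \o q : {ptws Y -> Y}) @ p).
  by apply: fmap_filter; exact: nbhs_filter.
apply/cvg_sup => y A [_ [[C oC <-] Cfpy sA]].
apply: (filterS sA).
have cy : {for p, continuous (fun q : {ptws Y -> Y} => f (q y))}.
  by apply: (@continuous_comp _ _ _ (fun q : {ptws Y -> Y} => q y) f);
    [exact: (@proj_continuous Y (fun=> Y) y)|exact: cf].
by apply: cy; exact: open_nbhs_nbhs.
Qed.

Lemma enveloping_comp (s : S) (p : {ptws Y -> Y}) :
  enveloping p -> enveloping (phi s \o p).
Proof.
move=> Ep V nV.
have /Ep[_ [[t _ <-] Vt]] :=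
  ptws_comp_continuous (@flow_continuous _ _ phi s) nV.
exists (phi s \o phi t); split=> //; exists (s * t)%g => //.
by apply/funext => y; rewrite flowM.
Qed.

Definition enveloping_flow (s : S) (p : enveloping) : enveloping :=
  exist _ (phi s \o val p) (mem_set (@enveloping_comp s _ (set_mem (valP p)))).

Lemma enveloping_flow1 p : enveloping_flow 1%g p = p.
Proof. by apply/val_inj/funext => y /=; rewrite flow1. Qed.

Lemma enveloping_flowM s t p :
  enveloping_flow (s * t)%g p = enveloping_flow s (enveloping_flow t p).
Proof. by apply/val_inj/funext => y /=; rewrite flowM. Qed.

Lemma enveloping_flow_continuous s : continuous (enveloping_flow s).
Proof.
move=> p A [_ [[C oC <-] Cp sA]].
apply: (@filterS _ (nbhs p) _ (enveloping_flow s @^-1` (set_val @^-1` C))).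
  by move=> q; exact: sA.
have cp : {for p, continuous (fun q : enveloping =>
    phi s \o set_val q : {ptws Y -> Y})}.
  apply: (@continuous_comp _ _ _ (@set_val _ enveloping)
    (fun q : {ptws Y -> Y} => phi s \o q : {ptws Y -> Y})).
    exact: initial_continuous.
  exact: ptws_comp_continuous (@flow_continuous _ _ phi s) _.
by apply: cp; exact: open_nbhs_nbhs.
Qed.

Definition enveloping_semiflow : semiflow S enveloping :=
  Semiflow enveloping_flow1 enveloping_flowM enveloping_flow_continuous.

End enveloping_semigroup.

(* Main.v *)
Require Import Defs.
From HB Require Import structures.
From mathcomp Require Import all_boot all_order all_algebra finmap.
From mathcomp Require Import all_classical all_reals all_analysis.
From mathcomp Require Import lra.
Import Order.TTheory GRing.Theory Num.Theory.

(** The homeomorphism restricts an element of E(2^X) to singletons, and its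
    inverse sends [p] in E(X) to the map that takes direct images under [p].

    Every [P] in E(2^X) maps singletons to singletons
    ([enveloping_hyper_set1]): each [s] does, and the sets with at most one
    point are closed in 2^X because X is Hausdorff.  Reading [P] on singletons
    thus gives a self-map of X ([point_map]), continuous in [P].

    In the other direction, equicontinuity passes from the maps [s] to their
    pointwise limits, so that evaluation E(X) x X -> X is jointly continuous
    ([enveloping_jointly_continuous]).  Hence every [p] in E(X) is continuous
    and sends closed sets to closed sets, and by compactness of a closed [A]
    the image of [A] under [p] depends continuously on [p] for the Vietoris
    topology ([image_map_continuous]).

    Both constructions are continuous and exchange the two maps induced by
    each [s].  As these are dense in the enveloping semigroups, both
    constructions take values in the right semigroup ([enveloping_map]).  The
    composite on E(X) is the identity since [p] sends {x} to {p x};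
    the one on E(2^X) is the identity by density, because 2^X is Hausdorff
    ([hyperspace_hausdorff]). *)

Local Open Scope classical_set_scope.

(** * Enveloping semigroups *)

Section enveloping_facts.
Context {S : monoidType} {Y : topologicalType} {phi : semiflow S Y}.

Lemma enveloping_eval_continuous (y : Y) :
  continuous (fun p : enveloping phi => val p y).
Proof.
move=> p.
apply: (@continuous_comp _ _ _ (@set_val _ (enveloping phi))
  (fun q : {ptws Y -> Y} => q y)).
  exact: initial_continuous.
exact: (@proj_continuous Y (fun=> Y) y).
Qed.

Lemma enveloping_eval_nbhs (p : enveloping phi) (y : Y) (U : set Y) :
  open U -> U (val p y) -> nbhs p [set q : enveloping phi | U (val q y)].
Proof.
move=> oU Upy; apply: (enveloping_eval_continuous y p).
exact: open_nbhs_nbhs.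
Qed.

Lemma ptws_continuous (T : topologicalType) (f : T -> {ptws Y -> Y}) :
  (forall y, continuous (fun t => f t y)) -> continuous f.
Proof.
move=> cf t.
have Ff : Filter (f @ t) by apply: fmap_filter; exact: nbhs_filter.
apply/cvg_sup => y A [_ [[C oC <-] Cfy sA]].
by apply: (filterS sA); apply: (cf y t); exact: open_nbhs_nbhs.
Qed.

Lemma enveloping_continuous (T : topologicalType) (f : T -> enveloping phi) :
  (forall y, continuous (fun t => val (f t) y)) -> continuous f.
Proof.
by move=> cf; apply: continuous_comp_initial; exact: ptws_continuous.
Qed.

Definition translation (s : S) : enveloping phi :=
  exist _ (flow phi s : {ptws Y -> Y})
    (mem_set (subset_closure (imageT (flow phi) s))).

(** The translations are dense, so a closed condition is inherited from them.
    All properties of limit points below are obtained in this way. *)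
Lemma enveloping_ind (P : set (enveloping phi)) :
  closed P -> (forall s, P (translation s)) -> forall p, P p.
Proof.
move=> cP Pt p; apply: cP => V [_ [[C oC <-] Cp sV]].
have /(_ C)[|_ [[s _ <-] Cs]] := set_mem (valP p).
  exact: open_nbhs_nbhs.
by exists (translation s); split => //; apply: sV.
Qed.

(** How to land in another enveloping semigroup without exhibiting a net: the
    preimage of this closed set is closed and contains the translations. *)
Lemma enveloping_map (Z : topologicalType)
    (psi : semiflow S Z) (f : enveloping phi -> {ptws Z -> Z}) :
  continuous f -> (forall s, f (translation s) = flow psi s) ->
  forall p, enveloping psi (f p).
Proof.
move=> cf fs; apply: enveloping_ind => [|s].
  apply: preimage_closed => [p _|]; first exact: cf.
  exact: closed_closure.
by rewrite fs; apply: subset_closure; exists s.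
Qed.

End enveloping_facts.

(** * Closed conditions *)

Lemma closed_equalizer (T Z : topologicalType) (f g : T -> Z) :
  hausdorff_space Z -> continuous f -> continuous g ->
  closed [set t | f t = g t].
Proof.
move=> hZ cf cg t clt; apply: hZ => A B nA nB.
have nfA : nbhs t (f @^-1` A) := cf t A nA.
have ngB : nbhs t (g @^-1` B) := cg t B nB.
have [u [fgu [Au Bu]]] := clt _ (filterI nfA ngB).
by exists (f u); split => //; rewrite fgu.
Qed.

Lemma closed_mdist_le (R : realType) (T : topologicalType) (X : metricType R)
    (f g : T -> X) (d : R) :
  continuous f -> continuous g -> closed [set t | (mdist (f t) (g t) <= d)%R].
Proof.
move=> cf cg t clt; apply/ler_addgt0Pl => e e0.
have e2 : (0 < e / 2)%R by rewrite divr_gt0.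
have nf : nbhs t (f @^-1` ball (f t) (e / 2)) := cf t _ (nbhsx_ballx _ _ e2).
have ng : nbhs t (g @^-1` ball (g t) (e / 2)) := cg t _ (nbhsx_ballx _ _ e2).
have [u /= [fgu []]] := clt _ (filterI nf ng).
rewrite !ballEmdist /= => fu gu.
have ft := metric_triangle (f t) (f u) (g t).
have gt := metric_triangle (f u) (g u) (g t).
rewrite (metric_sym (g u)) in gt; lra.
Qed.

(** * The Vietoris topology *)

Section vietoris.
Context {X : topologicalType}.

Lemma open_vietoris_subbase (i : bool * set X) :
  open i.2 -> open (vietoris_subbase i).
Proof.
move=> oi; exists [set vietoris_subbase i]; last by rewrite bigcup_set1.
move=> _ ->; exists [fset i]%fset.
  by move=> j; rewrite !inE => /eqP ->.
by rewrite set_fset1 bigcap_set1.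
Qed.

(** If [x] lies in [A] but not in [B], regularity gives disjoint open sets [U]
    around [x] and [V] around [B]; no closed set both meets [U] and is contained
    in [V], so the corresponding Vietoris open sets separate [A] from [B]. *)
Lemma hyperspace_hausdorff : regular_space X -> hausdorff_space (hyperspace X).
Proof.
move=> rX.
have sep (A B : hyperspace X) : ~ A `<=` B ->
    exists UV : set X * set X, [/\ open UV.1, open UV.2, A `&` UV.1 !=set0,
      B `<=` UV.2 & UV.1 `&` UV.2 = set0].
  move=> /existsNP[x /not_implyP[Ax Bx]].
  have [U [V [oU oV Ux BV UV]]] :=
    (regular_openP x).1 (rX x) B (@hyper_closed _ B) Bx.
  by exists (U, V); split => //; exists x.
have disj (A B : hyperspace X) : ~ A `<=` B ->
    ~ cluster (nbhs A) B /\ ~ cluster (nbhs B) A.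
  move=> /sep[[U V] /= [oU oV AU BV UV]].
  have nA : nbhs A (vietoris_subbase (false, U)).
    by apply: open_nbhs_nbhs; split => //; apply: open_vietoris_subbase.
  have nB : nbhs B (vietoris_subbase (true, V)).
    by apply: open_nbhs_nbhs; split => //; apply: open_vietoris_subbase.
  have no C : vietoris_subbase (false, U) C -> ~ vietoris_subbase (true, V) C.
    move=> [x [Cx Ux]] CV; have : (U `&` V) x by split => //; apply: CV.
    by rewrite UV.
  by split => [/(_ _ _ nA nB)|/(_ _ _ nB nA)] [C []] /no.
move=> A B cAB; apply: hyperspace_inj; apply/seteqP; split.
  by apply: contrapT => /disj[].
by apply: contrapT => /disj[].
Qed.

End vietoris.

(** * Restriction to points and extension to closed sets *)

Section conjugacy.
Context {R : realType} {S : monoidType} {X : metricType R}.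
Variables (cX : compact [set: X]) (phi : semiflow S X).
Local Notation psi := (hyperspace_semiflow cX phi).

Definition hyper_set1 (x : X) : hyperspace X :=
  Hyperspace (@accessible_closed_set1 X
    (hausdorff_accessible (@metric_hausdorff R X)) x)
    (ex_intro _ x erefl).

(** A limit of singletons is a singleton: if [P] sent a point to a set with two
    points, separate these by disjoint open sets; meeting both is a Vietoris
    open condition, which fails for all singletons. *)
Lemma enveloping_hyper_set1 (P : enveloping psi) (x : X) :
  is_subset1 (hyper_set (val P (hyper_set1 x))).
Proof.
move: P; apply: enveloping_ind => [|s]; last first.
  by move=> _ _ /= [_ -> <-] [_ -> <-].
apply/closure_id/seteqP; split; first exact: subset_closure.
move=> P clP y z Py Pz; apply: contrapT => /eqP yz.
have [[U V] /= [/set_mem Uy /set_mem Vz] [oU oV /eqP UV]] :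
    exists2 AB, (y \in AB.1 /\ z \in AB.2) &
                [/\ open AB.1, open AB.2 & AB.1 `&` AB.2 == set0].
  by have := @metric_hausdorff _ X; rewrite open_hausdorff; apply.
have nU W (w : X) : open W -> W w -> hyper_set (val P (hyper_set1 x)) w ->
    nbhs P
      [set Q : enveloping psi | hyper_set (val Q (hyper_set1 x)) `&` W !=set0].
  move=> oW Ww Pw.
  apply: (@enveloping_eval_nbhs _ _ psi _ _ (vietoris_subbase (false, W))).
    exact: open_vietoris_subbase.
  by exists w.
have [Q [Q1 [[u [Qu Uu]] [v [Qv Vv]]]]] :=
  clP _ (filterI (nU U y oU Uy Py) (nU V z oV Vz Pz)).
have : (U `&` V) u by split => //; rewrite (Q1 u v Qu Qv).
by rewrite UV.
Qed.

Definition point_map (P : enveloping psi) (x : X) : X :=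
  projT1 (cid (hyper_neq0 (val P (hyper_set1 x)))).

Lemma point_mapP P x : hyper_set (val P (hyper_set1 x)) (point_map P x).
Proof. by rewrite /point_map; case: cid. Qed.

Lemma point_map_unique P x y :
  hyper_set (val P (hyper_set1 x)) y -> point_map P x = y.
Proof. by move=> Py; exact: enveloping_hyper_set1 (point_mapP P x) Py. Qed.

Lemma point_map_continuous x : continuous (point_map ^~ x).
Proof.
(* That the whole value lies in an open set is a subbasic open condition,
   and it controls whichever point is chosen in the value. *)
move=> P U /nbhs_interior.
rewrite /= => nU; apply: (@filterS _ (nbhs P) _
   [set Q : enveloping psi | hyper_set (val Q (hyper_set1 x)) `<=` U^°]).
  by move=> Q /= QU; exact: interior_subset (QU _ (point_mapP Q x)).
apply: (@enveloping_eval_nbhs _ _ psi _ _ (vietoris_subbase (true, U^°))).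
  by apply: open_vietoris_subbase; exact: open_interior.
by move=> y /point_map_unique <-; exact: nbhs_singleton.
Qed.

Lemma point_map_enveloping P : enveloping phi (point_map P).
Proof.
apply: enveloping_map => [|s].
  by apply: ptws_continuous; exact: point_map_continuous.
by apply/funext => x; apply: point_map_unique => /=; exists x.
Qed.

Definition restrict_points (P : enveloping psi) : enveloping phi :=
  exist _ (point_map P : {ptws X -> X}) (mem_set (point_map_enveloping P)).

Lemma restrict_points_continuous : continuous restrict_points.
Proof. by apply: enveloping_continuous => x; exact: point_map_continuous. Qed.

Lemma restrict_points_flow s (P : enveloping psi) :
  restrict_points (enveloping_flow s P) = enveloping_flow s (restrict_points P).
Proof.
apply/val_inj/funext => x /=; apply: point_map_unique => /=.
by exists (point_map P x) => //; exact: point_mapP.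
Qed.

Hypothesis ephi : equicontinuous_semiflow phi.

(** This is where equicontinuity enters.  On a neighbourhood of [x] all
    translations, hence all their pointwise limits [q], satisfy one and the same
    modulus of continuity, and [q x] is close to [p x] for [q] near [p]. *)
Lemma enveloping_jointly_continuous (p : enveloping phi) (x : X) (U : set X) :
  nbhs (val p x) U -> \forall x' \near x & q \near p, U (val q x').
Proof.
move=> /nbhs_ballP[e /= e0 eU].
have e2 : (0 < e / 2)%R by rewrite divr_gt0.
(* The limit only satisfies a non-strict bound, hence the extra halving. *)
have e4 : (0 < e / 2 / 2)%R by rewrite divr_gt0.
have [V nV Vx] := ephi x _ e4.
exists (V, [set q : enveloping phi | ball (val p x) (e / 2) (val q x)]).
  split => //=; apply: (enveloping_eval_continuous x).
  exact: nbhsx_ballx.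
move=> [x' q] /= [Vx' pq]; apply: eU; rewrite (splitr e).
apply: ball_triangle pq _.
rewrite ballEmdist /=; apply: (@le_lt_trans _ _ (e / 2 / 2)%R); last by lra.
move: q; apply: enveloping_ind => [|s].
  by apply: closed_mdist_le; exact: enveloping_eval_continuous.
by rewrite metric_sym; apply: ltW; exact: Vx.
Qed.

Lemma enveloping_mem_continuous (p : enveloping phi) : continuous (val p).
Proof.
move=> x U /enveloping_jointly_continuous[[A B] /= [nA nB] AB].
apply: filterS nA => x' Ax'; apply: (AB (x', p)); split => //.
exact: nbhs_singleton.
Qed.

Lemma closed_enveloping_image (p : enveloping phi) (A : hyperspace X) :
  closed (val p @` A).
Proof.
apply: compact_closed; first exact: metric_hausdorff.
apply: continuous_compact.
  by apply: continuous_subspaceT; exact: enveloping_mem_continuous.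
by apply: (subclosed_compact _ cX) => //; exact: hyper_closed.
Qed.

Definition image_map (p : enveloping phi) (A : hyperspace X) : hyperspace X :=
  Hyperspace (closed_enveloping_image p A)
    (image_nonempty (val p) (hyper_neq0 A)).

(** For the condition that the image meets [U], one point of [A] is enough.  For
    the condition that it is contained in [U], joint continuity yields
    neighbourhoods of [p] depending on the point of [A], and the tube lemma over
    the compact set [A] makes them uniform. *)
Lemma image_map_continuous A : continuous (image_map ^~ A).
Proof.
move=> p; apply: hyperspace_cvg => -[[] U] /= oU.
  move=> pAU.
  have cA : near_covering (hyper_set A).
    apply/compact_near_coveringP.
    by apply: (subclosed_compact _ cX) => //; exact: hyper_closed.
  have pU x : hyper_set A x -> \forall x' \near x & q \near p, U (val q x').
    move=> Ax; apply: enveloping_jointly_continuous.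
    by apply: open_nbhs_nbhs; split => //; apply: pAU; exists x.
  apply: (@filterS _ (nbhs p) _
    [set q : enveloping phi | hyper_set A `<=` (fun x => U (val q x))]).
    by move=> q qAU _ [x Ax <-]; exact: qAU.
  exact: cA _ (nbhs p) (fun (q : enveloping phi) x => U (val q x)) _ pU.
move=> [_ [[x Ax <-] Upx]].
apply: (@filterS _ (nbhs p) _ [set q : enveloping phi | U (val q x)]).
  by move=> q Uqx; exists (val q x); split => //; exists x.
exact: enveloping_eval_nbhs.
Qed.

Lemma image_map_enveloping p : enveloping psi (image_map p).
Proof.
apply: enveloping_map => [|s].
  by apply: ptws_continuous; exact: image_map_continuous.
by apply/funext => A; exact: hyperspace_inj.
Qed.

Definition extend_to_sets (p : enveloping phi) : enveloping psi :=
  exist _ (image_map p : {ptws hyperspace X -> hyperspace X})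
    (mem_set (image_map_enveloping p)).

Lemma extend_to_sets_continuous : continuous extend_to_sets.
Proof. by apply: enveloping_continuous => A; exact: image_map_continuous. Qed.

Lemma extend_to_setsK : cancel extend_to_sets restrict_points.
Proof.
move=> p; apply/val_inj/funext => x; apply: point_map_unique => /=.
by exists x.
Qed.

(** Evaluated at a fixed [A], both sides are continuous maps into the Hausdorff
    space 2^X that agree on the translations. *)
Lemma restrict_pointsK : cancel restrict_points extend_to_sets.
Proof.
move=> P; apply/val_inj/funext => A; move: P; apply: enveloping_ind => [|s].
  apply: closed_equalizer.
  - exact/hyperspace_hausdorff/uniform_regular.
  - move=> P; apply: (@continuous_comp _ _ _ restrict_points (image_map ^~ A)).
      exact: restrict_points_continuous.
    exact: image_map_continuous.
  - exact: enveloping_eval_continuous.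
apply: hyperspace_inj => /=; apply: eq_imagel => x _.
by apply: point_map_unique => /=; exists x.
Qed.

End conjugacy.

Theorem theorem13p9 (R : realType) (S : monoidType) (X : metricType R)
    (cX : compact [set: X]) (phi : semiflow S X)
    (ephi : equicontinuous_semiflow phi) :
  conjugate (enveloping_semiflow (hyperspace_semiflow cX phi))
            (enveloping_semiflow phi).
Proof.
exists (@restrict_points R S X cX phi); split; last first.
  exact: restrict_points_flow.
split; first exact: restrict_points_continuous.
exists (extend_to_sets cX phi ephi); split.
- exact: extend_to_sets_continuous.
- exact: restrict_pointsK.
- exact: extend_to_setsK.
Qed.
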